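(* Let $R=S[x_1, x_1^{-1}; f_1]\cdots[x_n, x_n^{-1}; f_n]$ be an iterated skew-Laurent ring extension of a ring $S$ such that (1) for each $j>i$, $f_j(x_i)=q_{ji}x_i$ for some unit $q_{ji}\in S$; (2) each $f_i$ is the identity on $S$. If $S$ is F-noetherian, then so is $R$.
   Context: All rings have an identity $1$, and subrings contain $1$; ''noetherian'' means left and right noetherian. A ring $R$ is F-noetherian if every finite subset of $R$ is contained in a noetherian subring of $R$. For a ring $T$ and a ring automorphism $f$ of $T$, the skew-Laurent ring $T[x,x^{-1};f]$ is the free left $T$-module with basis $\{x^m : m\in\mathbb{Z}\}$ and multiplication determined by $xt=f(t)x$ for $t\in T$. In an iterated skew-Laurent extension, $f_j$ is an automorphism of $S[x_1,x_1^{-1};f_1]\cdots[x_{j-1},x_{j-1}^{-1};f_{j-1}]$. *)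

(* Defs.v *)
From HB Require Import structures.
From mathcomp Require Import all_boot all_order all_algebra.

Set Implicit Arguments.
Unset Strict Implicit.
Unset Printing Implicit Defensive.

Import GRing.Theory.
Local Open Scope ring_scope.

(* Rings are [pzRingType]: associative, unital, not necessarily commutative,
   with the zero ring allowed. *)

(* Ideals are [Prop]-valued, so that no decidability is imposed on them. *)
Definition left_ideal (R : pzRingType) (I : R -> Prop) : Prop :=
  [/\ I 0,
      forall a b, I a -> I b -> I (a + b)
    & forall r a, I a -> I (r * a)].

Definition right_ideal (R : pzRingType) (I : R -> Prop) : Prop :=
  [/\ I 0,
      forall a b, I a -> I b -> I (a + b)
    & forall r a, I a -> I (a * r)].

Definition left_noetherian (R : pzRingType) : Prop :=
  forall I : R -> Prop, left_ideal I ->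
    exists (n : nat) (g : 'I_n -> R),
      forall a, I a <-> exists c : 'I_n -> R, a = \sum_(i < n) c i * g i.

Definition right_noetherian (R : pzRingType) : Prop :=
  forall I : R -> Prop, right_ideal I ->
    exists (n : nat) (g : 'I_n -> R),
      forall a, I a <-> exists c : 'I_n -> R, a = \sum_(i < n) g i * c i.

Definition noetherian (R : pzRingType) : Prop :=
  left_noetherian R /\ right_noetherian R.

(* A finite subset is given by a list of its elements; [U] is the subset [P]
   of [R] with the ring structure (including the identity) induced from [R]. *)
Definition F_noetherian (R : pzRingType) : Prop :=
  forall s : seq R, exists (P : pred R) (U : subPzRingType P),
    {subset s <= P} /\ noetherian U.

Definition invertible (R : pzRingType) (u : R) : Prop :=
  exists v : R, u * v = 1 /\ v * u = 1.

(* [x ^ m] for [m : int], when [xinv] is the two-sided inverse of [x]. *)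
Definition zpow (R : pzRingType) (x xinv : R) (m : int) : R :=
  match m with
  | Posz k => x ^+ k
  | Negz k => xinv ^+ k.+1
  end.

(* [R], together with [iota : T -> R], [x] and its inverse [xinv], is the
   skew-Laurent ring T[x, x^-1; f].  These data determine [R] uniquely up to
   isomorphism over [T]; [iota] is injective by [skew_free] at [[:: 0]]. *)
Record skew_laurent (T R : pzRingType) (f : {rmorphism T -> T})
    (iota : {rmorphism T -> R}) (x xinv : R) : Prop := SkewLaurent {
  skew_aut : bijective f;
  skew_mulV : x * xinv = 1;
  skew_Vmul : xinv * x = 1;
  skew_comm : forall t : T, x * iota t = iota (f t) * x;
  skew_span : forall r : R, exists (s : seq int) (c : int -> T),
    uniq s /\ r = \sum_(m <- s) iota (c m) * zpow x xinv m;
  skew_free : forall (s : seq int) (c : int -> T), uniq s ->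
    \sum_(m <- s) iota (c m) * zpow x xinv m = 0 ->
    forall m, m \in s -> c m = 0
}.

(* An iterated extension is a tower T 0 -> T 1 -> ..., where T j.+1 is obtained
   from T j by adjoining [x j], so that variables are numbered from 0. *)

Fixpoint tower_base (T : nat -> pzRingType)
    (iota : forall j, {rmorphism T j -> T j.+1}) (j : nat) : T 0%N -> T j :=
  match j with
  | 0 => fun s => s
  | k.+1 => fun s => iota k (tower_base iota k s)
  end.

(* The variable [x i] viewed in [T j], for [i < j]; the value is the irrelevant
   0 when [j <= i]. *)
Fixpoint tower_var (T : nat -> pzRingType)
    (iota : forall j, {rmorphism T j -> T j.+1})
    (x : forall j, T j.+1) (i j : nat) : T j :=
  match j with
  | 0 => 0
  | k.+1 => if i == k then x k else iota k (tower_var iota x i k)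
  end.

(* T n is T 0 [x 0, (x 0)^-1; f 0] ... [x n.-1, (x n.-1)^-1; f n.-1].  The
   components of the families at indices beyond this are unconstrained. *)
Definition iterated_skew_laurent (n : nat) (T : nat -> pzRingType)
    (iota : forall j, {rmorphism T j -> T j.+1})
    (f : forall j, {rmorphism T j -> T j})
    (x xinv : forall j, T j.+1) : Prop :=
  forall j, (j < n)%N -> skew_laurent (f j) (iota j) (x j) (xinv j).

(* Main.v *)
Require Import Defs.
From HB Require Import structures.
From mathcomp Require Import all_boot all_order all_algebra.
From mathcomp Require Import boolp.

Set Implicit Arguments.
Unset Strict Implicit.
Unset Printing Implicit Defensive.

Import GRing.Theory.
Local Open Scope ring_scope.

(** Write [S] for [T 0], and [X i], [Y i] for the variables and their inverses
    inside the top ring [T n], and let a finite subset of [T n] be given. Each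
    of its elements is a polynomial expression in the [X i], the [Y i] and
    finitely many elements of [S] ([tower_finitely_supported]). As [S] is
    F-noetherian, all these elements of [S], together with the finitely many
    units [q] in the action of the [f j] on the variables, and their inverses,
    lie in one noetherian subring [P] of [S]. The subring of [T n] generated by
    the image of [P], the [X i] and the [Y i] contains the given finite subset;
    it remains to see that it is noetherian.

    Let [L k] be the subring generated by the image of [P] and by the [X i],
    [Y i] with [i < k]. As [f k] fixes [S] and multiplies [X i] by [q], [X k]
    commutes with the image of [P], and [X k] and [X i] commute up to a factor
    which is a unit of that image. So conjugation by [X k] maps [L k] onto
    itself ([torus_conj]), and [L k.+1] arises from [L k] by adjoining a unit
    that normalises [L k]. Such an extension of a noetherian ring is noetherian
    ([hilbert_basis]), by Hilbert's argument with leading coefficients.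

    The argument produces generators of ideals and never compares coefficients
    of equal elements, so it applies to every ring generated by [P] and a
    normalising unit, a homomorphic image of the skew-Laurent ring over [P].
    Hence the whole proof takes place in the ring [T n], with subrings and
    ideals given by predicates on it.  Only at the end is the subring turned
    into a type. *)

(** * Collecting finite supports *)

(** A monotone property [K i] of finite supports which can be reached for each
    of finitely many [i] can be reached for all of them at once.  The
    constraint [Q] on the members of the support is separate from [K] because
    it is not monotone. *)
Lemma seq_collect (I : eqType) (T : choiceType) (Q : T -> Prop)
    (K : I -> seq T -> Prop) (l : seq I) :
  (forall i s s', {subset s <= s'} -> K i s -> K i s') ->
  (forall i, i \in l ->
     exists s, (forall y, y \in s -> Q y) /\ K i s) ->
  exists s, (forall y, y \in s -> Q y) /\ forall i, i \in l -> K i s.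
Proof.
move=> Kmono; elim: l => [|i l IHl] Kl; first by exists [::].
have [j jl | s [sQ sK]] := IHl; first by apply: Kl; rewrite inE jl orbT.
have [s' [s'Q s'K]] := Kl i (mem_head _ _).
exists (s' ++ s); split=> [y|j].
  by rewrite mem_cat => /orP[/s'Q|/sQ].
rewrite inE => /orP[/eqP-> | /sK].
  by apply: Kmono s'K => y ys; rewrite mem_cat ys.
by apply: Kmono => y ys; rewrite mem_cat ys orbT.
Qed.

Lemma seq_collect_nat (T : choiceType) (K : nat -> seq T -> Prop) n :
  (forall i s s', {subset s <= s'} -> K i s -> K i s') ->
  (forall i, (i < n)%N -> exists s, K i s) ->
  exists s, forall i, (i < n)%N -> K i s.
Proof.
move=> Kmono Kn.
have [|i|s [_ sK]] := @seq_collect _ _ (fun=> True) K (seq.iota 0 n).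
- exact: Kmono.
- by rewrite mem_iota => /Kn[s Ks]; exists s.
by exists s => i i_n; apply: sK; rewrite mem_iota.
Qed.

(** * Subrings and one-sided ideals as predicates *)

Section Subrings.
Variable R : pzRingType.
Implicit Types (P Q I : R -> Prop) (g h : seq R).

Definition is_subring P : Prop :=
  [/\ P 1, forall a b, P a -> P b -> P (a - b)
    & forall a b, P a -> P b -> P (a * b)].

Lemma subring0 P : is_subring P -> P 0.
Proof. by case=> P1 PB _; rewrite -(subrr 1); apply: PB. Qed.

Lemma subringN P a : is_subring P -> P a -> P (- a).
Proof.
move=> hP Pa; rewrite -sub0r; case: (hP) => _ PB _.
by apply: PB => //; apply: subring0.
Qed.

Lemma subringD P a b : is_subring P -> P a -> P b -> P (a + b).
Proof.
move=> hP Pa Pb; rewrite -[b]opprK; case: (hP) => _ PB _.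
by apply: PB => //; apply: subringN.
Qed.

Lemma subringX P a k : is_subring P -> P a -> P (a ^+ k).
Proof.
case=> P1 _ PM Pa; elim: k => [|k IHk]; first by rewrite expr0.
by rewrite exprS; apply: PM.
Qed.

(** Both the generated subring and the left span below are intersections of
    all closed predicates: to prove something of their elements it suffices to
    exhibit a closed predicate. *)
Definition generated (A : R -> Prop) (r : R) : Prop :=
  forall Q, is_subring Q -> (forall a, A a -> Q a) -> Q r.

Lemma generated_subring (A : R -> Prop) : is_subring (generated A).
Proof.
split=> [Q [] //|a b ha hb Q hQ AQ|a b ha hb Q hQ AQ]; case: (hQ) => _ QB QM.
  by apply: QB; [apply: ha | apply: hb].
by apply: QM; [apply: ha | apply: hb].
Qed.

Lemma mem_generated (A : R -> Prop) a : A a -> generated A a.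
Proof. by move=> Aa Q _; apply. Qed.

Definition left_ideal_in P I : Prop :=
  [/\ I 0, forall a b, I a -> I b -> I (a + b)
    & forall r a, P r -> I a -> I (r * a)].

Definition left_span P g (a : R) : Prop :=
  forall I, left_ideal_in P I -> (forall y, y \in g -> I y) -> I a.

Lemma left_span_ideal P g : left_ideal_in P (left_span P g).
Proof.
split=> [I []|a b sa sb I hI gI|r a Pr sa I hI gI] //.
  by case: (hI) => _ ID _; apply: ID; [apply: sa | apply: sb].
by case: (hI) => _ _ IM; apply: IM => //; apply: sa.
Qed.

Lemma left_idealB P I a b : is_subring P -> left_ideal_in P I ->
  I a -> I b -> I (a - b).
Proof.
move=> hP [_ ID IM] Ia Ib; apply: ID => //; rewrite -mulN1r; apply: IM => //.
by apply: subringN => //; case: hP.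
Qed.

Definition left_noetherian_in P : Prop :=
  forall I, left_ideal_in P I -> (forall a, I a -> P a) ->
    exists g, (forall y, y \in g -> I y) /\ forall a, I a -> left_span P g a.

End Subrings.

(** * The Hilbert basis theorem for one adjoined unit *)

(** [C] is generated by [P] and the unit [x], and conjugation by [x] maps [P]
    onto [P]. *)
Section HilbertBasis.
Variables (R : pzRingType) (P C : R -> Prop) (x xi : R).
Hypotheses (xxi : x * xi = 1) (xix : xi * x = 1).
Hypotheses (P_subring : is_subring P) (C_subring : is_subring C).
Hypotheses (conjP : forall a, P a -> P (x * a * xi)).
Hypotheses (conjVP : forall a, P a -> P (xi * a * x)).
Hypotheses (PC : forall a, P a -> C a) (Cx : C x) (Cxi : C xi).

Lemma unitXK k r : x ^+ k * (xi ^+ k * r) = r.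
Proof.
rewrite mulrA; elim: k => [|k IHk]; first by rewrite !expr0 !mul1r.
by rewrite exprSr exprS mulrA -[_ * x * xi]mulrA xxi mulr1.
Qed.

Lemma unitVXK k r : xi ^+ k * (x ^+ k * r) = r.
Proof.
rewrite mulrA; elim: k => [|k IHk]; first by rewrite !expr0 !mul1r.
by rewrite exprSr exprS mulrA -[_ * xi * x]mulrA xix mulr1.
Qed.

Lemma conjXP k a : P a -> P (x ^+ k * a * xi ^+ k).
Proof.
move=> Pa; elim: k => [|k IHk]; first by rewrite !expr0 mul1r mulr1.
have -> : x ^+ k.+1 * a * xi ^+ k.+1 = x * (x ^+ k * a * xi ^+ k) * xi.
  by rewrite exprS exprSr !mulrA.
exact: conjP.
Qed.

Lemma conjVXP k a : P a -> P (xi ^+ k * a * x ^+ k).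
Proof.
move=> Pa; elim: k => [|k IHk]; first by rewrite !expr0 mul1r mulr1.
have -> : xi ^+ k.+1 * a * x ^+ k.+1 = xi * (xi ^+ k * a * x ^+ k) * x.
  by rewrite exprS exprSr !mulrA.
exact: conjVP.
Qed.

(** The polynomials of degree less than [k] in [x], with coefficients in [P]
    written to the right of the powers of [x].  With this convention, left
    multiplication by [x] does not change the leading coefficient. *)
Fixpoint poly_lt (k : nat) (r : R) : Prop :=
  match k with
  | 0 => r = 0
  | j.+1 => exists2 a, P a & poly_lt j (r - x ^+ j * a)
  end.

Lemma poly_ltW k r : poly_lt k r -> poly_lt k.+1 r.
Proof.
by exists 0; [exact: subring0 | rewrite mulr0 subr0].
Qed.

Lemma poly_lt_ideal k : left_ideal_in P (poly_lt k).
Proof.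
have P0 := subring0 P_subring; case: (P_subring) => _ _ PM.
elim: k => [|k [IH0 IHD IHM]]; split=> //=.
- by move=> a b -> ->; rewrite addr0.
- by move=> r a _ ->; rewrite mulr0.
- exact: poly_ltW.
- move=> r s [a Pa ra] [b Pb sb]; exists (a + b); first exact: subringD.
  by rewrite mulrDr opprD addrACA; apply: IHD.
(* [b * x ^+ k = x ^+ k * b'] with [b'] the conjugate of [b]. *)
- move=> b r Pb [a Pa ra]; exists (xi ^+ k * b * x ^+ k * a).
    by apply: PM => //; apply: conjVXP.
  by rewrite -!mulrA unitXK -mulrBr; apply: IHM.
Qed.

Lemma poly_lt_shift k r : poly_lt k r -> poly_lt k.+1 (x * r).
Proof.
elim: k r => [|k IHk] r; first by move=> ->; rewrite mulr0; apply: poly_ltW.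
case=> a Pa ra; exists a => //.
by rewrite exprS -mulrA -mulrBr; apply: IHk.
Qed.

Definition shifts_to_poly (r : R) : Prop := exists N k, poly_lt k (x ^+ N * r).

Lemma shifts_to_poly_raise r N k M l : poly_lt k (x ^+ N * r) ->
  poly_lt (M + k + l) (x ^+ (M + N) * r).
Proof.
move=> h; elim: l => [|l IHl]; last by rewrite addnS; apply: poly_ltW.
rewrite addn0; elim: M => [//|M IHM].
by rewrite !addSn exprS -mulrA; apply: poly_lt_shift.
Qed.

Lemma shifts_to_polyD r s :
  shifts_to_poly r -> shifts_to_poly s -> shifts_to_poly (r + s).
Proof.
move=> [N [k rk]] [M [l sl]]; exists (M + N)%N, (M + k + (N + l))%N.
rewrite mulrDr; case: (poly_lt_ideal (M + k + (N + l))) => _ D _; apply: D.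
  exact: shifts_to_poly_raise.
by rewrite [(M + N)%N]addnC [(M + k + _)%N]addnC; apply: shifts_to_poly_raise.
Qed.

Lemma shifts_to_polyM b r : P b -> shifts_to_poly r -> shifts_to_poly (b * r).
Proof.
move=> Pb [N [k rk]]; exists N, k.
have -> : x ^+ N * (b * r) = (x ^+ N * b * xi ^+ N) * (x ^+ N * r).
  by rewrite -!mulrA unitVXK.
by case: (poly_lt_ideal k) => _ _; apply=> //; apply: conjXP.
Qed.

(** The products of such elements are hard to handle directly.  But those [r]
    whose left multiplication preserves [shifts_to_poly] form a subring, which
    contains [P], [x] and [xi]; apply the multiplication to [1]. *)
Lemma generated_shifts_to_poly r :
  (forall Q, is_subring Q -> (forall a, P a -> Q a) -> Q x -> Q xi -> Q r) ->
  shifts_to_poly r.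
Proof.
move=> r_gen; rewrite -[r]mulr1.
apply: (r_gen (fun r => forall w, shifts_to_poly w -> shifts_to_poly (r * w))).
- split=> [w|a b ha hb w hw|a b ha hb w hw]; first by rewrite mul1r.
    rewrite mulrBl -mulrN; apply: shifts_to_polyD; first exact: ha.
    apply: hb; rewrite -mulN1r; apply: shifts_to_polyM => //.
    by apply: subringN => //; case: P_subring.
  by rewrite -mulrA; apply/ha/hb.
- by move=> a Pa w; apply: shifts_to_polyM.
- move=> w [N [k wk]]; exists N, k.+1.
  by rewrite mulrA -exprSr exprS -mulrA; apply: poly_lt_shift.
- move=> w [N [k wk]]; exists N.+1, k.
  by rewrite exprSr -mulrA [x * _]mulrA xxi mul1r.
- exists 0%N, 1%N; rewrite mul1r; exists 1; first by case: P_subring.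
  by rewrite expr0 mulr1 subrr.
Qed.

Section Ideal.
Variable I : R -> Prop.
Hypothesis I_ideal : left_ideal_in C I.

(** The leading coefficients of the members of [K] of degree at most [k].  As
    representations by coefficients need not be unique, [a] can be the leading
    coefficient of some representation only. *)
Definition lead_coef_in (K : R -> Prop) k (a : R) : Prop :=
  P a /\ exists2 r, K r & poly_lt k (r - x ^+ k * a).

(** The leading coefficient is multiplied by [b] when the element of [K] is
    multiplied by the conjugate of [b] under [x ^+ k]. *)
Lemma lead_coef_ideal K k :
  left_ideal_in C K -> left_ideal_in P (lead_coef_in K k).
Proof.
case=> K0 KD KM; case: (P_subring) => P1 PB PM.
case: (poly_lt_ideal k) => p0 pD pM; split.
- by split; [exact: subring0 | exists 0; rewrite // mulr0 subr0].
- move=> a b [Pa [r Kr ra]] [Pb [s Ks sb]]; split; first exact: subringD.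
  by exists (r + s); [exact: KD | rewrite mulrDr opprD addrACA; apply: pD].
- move=> b a Pb [Pa [r Kr ra]]; split; first exact: PM.
  exists ((x ^+ k * b * xi ^+ k) * r); first by apply/KM => //; apply/PC/conjXP.
  have -> : x ^+ k * (b * a) = (x ^+ k * b * xi ^+ k) * (x ^+ k * a).
    by rewrite -!mulrA unitVXK.
  by rewrite -mulrBr; apply: pM => //; apply: conjXP.
Qed.

Lemma lead_coef_shift K k m a : left_ideal_in C K ->
  lead_coef_in K k a -> lead_coef_in K (m + k) a.
Proof.
move=> [_ _ KM] ha; elim: m => [//|m [Pa [r Kr ra]]]; split=> //.
exists (x * r); first exact: KM.
by rewrite addSn exprS -mulrA -mulrBr; apply: poly_lt_shift.
Qed.

Hypothesis P_noeth : left_noetherian_in P.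

(** One lift to [I] for each generator of the ideal of leading coefficients
    suffices: the leading coefficients of the span of the lifts form an ideal
    again. *)
Lemma lead_coef_lift k : exists h : seq R, (forall y, y \in h -> I y) /\
  forall h' : seq R, {subset h <= h'} -> forall a, lead_coef_in I k a ->
    lead_coef_in (left_span C h') k a.
Proof.
have [a []//|g [gI gspan]] := P_noeth (lead_coef_ideal k I_ideal).
pose K y (h : seq R) := lead_coef_in (fun r => r \in h) k y.
have [|y yg|h [hI hK]] := @seq_collect _ _ I K g.
- by move=> y s s' ss' [Py [r /ss' rs ry]]; split=> //; exists r.
- have [Py [r Ir ry]] := gI _ yg; exists [:: r]; split=> [z|].
    by rewrite inE => /eqP ->.
  by split=> //; exists r; rewrite ?mem_head.
- exists h; split=> // h' hh' a /gspan; apply.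
    exact/lead_coef_ideal/left_span_ideal.
  move=> y /hK [Py [r /hh' rh ry]]; split=> //; exists r => //.
  by move=> L _; apply.
Qed.

(** The leading coefficient ideals increase with [k], by multiplication by [x],
    so their union is an ideal.  Its finitely many generators occur at a common
    stage, where the chain becomes stationary. *)
Lemma lead_coef_bound :
  exists d, forall k a, lead_coef_in I k a -> lead_coef_in I d a.
Proof.
pose J a := exists k, lead_coef_in I k a.
have [||g [gJ gspan]] := P_noeth (I := J).
- split.
  + by exists 0%N; case: (lead_coef_ideal 0 I_ideal).
  + move=> a b [k ak] [l bl]; exists (k + l)%N.
    case: (lead_coef_ideal (k + l) I_ideal) => _ D _; apply: D.
      by rewrite addnC; apply: lead_coef_shift.
    exact: lead_coef_shift.
  + move=> b a Pb [k ak]; exists k.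
    by case: (lead_coef_ideal k I_ideal) => _ _; apply.
- by move=> a [k []].
have [d gd] : exists d, forall y, y \in g -> lead_coef_in I d y.
  elim: g gJ {gspan} => [|y g IHg] gJ; first by exists 0%N.
  have [z zg|d gd] := IHg; first by apply: gJ; rewrite inE zg orbT.
  have [k yk] := gJ y (mem_head _ _); exists (d + k)%N => z.
  rewrite inE => /orP[/eqP->|/gd zd]; first exact: lead_coef_shift.
  by rewrite addnC; apply: lead_coef_shift.
exists d => k a ak; apply: (gspan a) => //; first by exists k.
exact: lead_coef_ideal.
Qed.

(** Lifts for the degrees up to the stationary stage serve the higher degrees
    too, after multiplication by a power of [x]. *)
Lemma lead_coef_lift_all : exists h : seq R, (forall y, y \in h -> I y) /\
  forall k a, lead_coef_in I k a -> lead_coef_in (left_span C h) k a.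
Proof.
have [d Id] := lead_coef_bound.
pose K k (h : seq R) := forall h' : seq R, {subset h <= h'} ->
  forall a, lead_coef_in I k a -> lead_coef_in (left_span C h') k a.
have [||h [hI hK]] := @seq_collect _ _ I K (seq.iota 0 d.+1).
- by move=> k s s' ss' Ks h' s'h'; apply: Ks => y /ss' /s'h'.
- by move=> k _; apply: lead_coef_lift.
exists h; split=> // k a ak; case: (leqP k d) => [kd|/ltnW dk].
  by apply: hK => //; rewrite mem_iota.
rewrite -(subnK dk); apply: lead_coef_shift; first exact: left_span_ideal.
by apply: hK => //; [rewrite mem_iota add0n leqnn | apply: Id ak].
Qed.

End Ideal.

Hypothesis C_min : forall r Q, C r ->
  is_subring Q -> (forall a, P a -> Q a) -> Q x -> Q xi -> Q r.

(** Lifts of all leading coefficients span [I]: an element of [I] becomes a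
    polynomial in [x] when multiplied by a power of the unit [x], and its degree
    is lowered by subtracting an element of the span with the same leading
    coefficient. *)
Theorem left_hilbert_basis : left_noetherian_in P -> left_noetherian_in C.
Proof.
move=> P_noeth I I_ideal IC.
have [h [hI hlead]] := lead_coef_lift_all I_ideal P_noeth.
exists h; split=> //.
have span_ideal := left_span_ideal C h.
case: (span_ideal) => span0 spanD spanM.
have poly_span k r : I r -> poly_lt k r -> left_span C h r.
  elim: k r => [|k IHk] r Ir; first by move=> ->.
  case=> a Pa ra.
  have [|_ [s sh sa]] := hlead k a; first by split=> //; exists r.
  rewrite -(subrK s r); apply: spanD => //; apply: IHk.
    by apply: (left_idealB C_subring I_ideal) => //; apply: sh.
  have -> : r - s = (r - x ^+ k * a) - (s - x ^+ k * a).
    by rewrite opprB addrA subrK.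
  exact: (left_idealB P_subring (poly_lt_ideal k)).
move=> r Ir.
have [N [k rk]] : shifts_to_poly r.
  by apply: generated_shifts_to_poly => Q; apply: C_min; apply: IC.
rewrite -(unitVXK N r); apply: spanM; first exact: subringX.
apply: poly_span rk; case: (I_ideal) => _ _; apply=> //.
exact: subringX.
Qed.

End HilbertBasis.

(** Right ideals are the left ideals of the converse ring. *)
Definition noetherian_in (R : pzRingType) (P : R -> Prop) : Prop :=
  left_noetherian_in P /\ @left_noetherian_in R^c P.

(** The hypotheses on [x] are symmetric: in the converse ring the two
    conjugations are exchanged. *)
Theorem hilbert_basis (R : pzRingType) (P C : R -> Prop) (x xi : R) :
  x * xi = 1 -> xi * x = 1 -> is_subring P -> is_subring C ->
  (forall a, P a -> P (x * a * xi)) -> (forall a, P a -> P (xi * a * x)) ->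
  (forall a, P a -> C a) -> C x -> C xi ->
  (forall r Q, C r -> is_subring Q -> (forall a, P a -> Q a) ->
     Q x -> Q xi -> Q r) ->
  noetherian_in P -> noetherian_in C.
Proof.
move=> xxi xix hP hC conjP conjVP PC Cx Cxi C_min [nl nr].
have converse_subring (S : pzRingType) Q : @is_subring S Q -> @is_subring S^c Q.
  by case=> Q1 QB QM; split=> // a b Qa Qb; apply: QM.
split; first exact: (@left_hilbert_basis R P C x xi).
apply: (@left_hilbert_basis R^c P C x xi) => //; try exact: converse_subring.
- by move=> a Pa; rewrite -mulrA; apply: conjVP.
- by move=> a Pa; rewrite -mulrA; apply: conjP.
- move=> r Q Cr [Q1 QB QM]; apply: C_min Cr _.
  by split=> // a b Qa Qb; apply: QM.
Qed.

(** * Adjoining units that commute up to scalars *)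

Lemma generated_conj (R : pzRingType) (A : R -> Prop) (u w : R) :
  u * w = 1 -> w * u = 1 -> (forall a, A a -> generated A (u * a * w)) ->
  forall a, generated A a -> generated A (u * a * w).
Proof.
move=> uw wu conjA a Aa; have [G1 GB GM] := generated_subring A.
apply: (Aa (fun a => generated A (u * a * w))); last exact: conjA.
split=> [|b c Gb Gc|b c Gb Gc].
- by rewrite mulr1 uw.
- by rewrite mulrBr mulrBl; apply: GB.
- have -> : u * (b * c) * w = (u * b * w) * (u * c * w).
    by rewrite -!mulrA [w * _]mulrA wu mul1r.
  exact: GM.
Qed.

Lemma inv_uniq (R : pzRingType) (a b c : R) : b * a = 1 -> a * c = 1 -> b = c.
Proof. by move=> ba ac; rewrite -[b]mulr1 -ac mulrA ba mul1r. Qed.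

Section QuantumTorus.
Variables (R : pzRingType) (P : R -> Prop) (X Y : nat -> R) (n : nat).
Hypotheses (P_subring : is_subring P).
Hypotheses (XY : forall i, (i < n)%N -> X i * Y i = 1).
Hypotheses (YX : forall i, (i < n)%N -> Y i * X i = 1).
Hypotheses (XC : forall i a, (i < n)%N -> P a -> X i * a = a * X i).
Hypothesis Xq : forall i j, (i < j)%N -> (j < n)%N ->
  exists q v, [/\ P q, P v, q * v = 1, v * q = 1
                & X j * X i = q * (X i * X j)].

Definition torus_gens k (r : R) : Prop :=
  P r \/ exists2 i, (i < k)%N & r = X i \/ r = Y i.

(** A homomorphic image of the quantum torus over [P] in [k] variables. *)
Definition torus k : R -> Prop := generated (torus_gens k).

Lemma torus_subring k : is_subring (torus k).
Proof. exact: generated_subring. Qed.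

Lemma torus_coef k a : P a -> torus k a.
Proof. by move=> Pa; apply: mem_generated; left. Qed.

Lemma torus_X i k : (i < k)%N -> torus k (X i).
Proof. by move=> ik; apply: mem_generated; right; exists i; [|left]. Qed.

Lemma torus_Y i k : (i < k)%N -> torus k (Y i).
Proof. by move=> ik; apply: mem_generated; right; exists i; [|right]. Qed.

Lemma YC i a : (i < n)%N -> P a -> Y i * a = a * Y i.
Proof.
move=> i_n Pa; rewrite -[LHS]mulr1 -(XY i_n) mulrA -[Y i * a * _]mulrA -XC //.
by rewrite mulrA YX // mul1r.
Qed.

(** Conjugation by [X k] fixes [P] and maps [X i] to [q * X i].  So the inverse
    conjugation maps [X i] to [v * X i], and the images of [Y i] are the
    inverses [Y i * v] and [Y i * q]. *)
Lemma torus_conj k a : (k < n)%N -> torus k a ->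
  torus k (X k * a * Y k) /\ torus k (Y k * a * X k).
Proof.
move=> k_n ka; have [_ _ TM] := torus_subring k.
have XYk := XY k_n; have YXk := YX k_n.
split; apply: generated_conj ka => // b.
- case=> [Pb|[i ik [->|->]]].
  + by rewrite XC // -mulrA XYk mulr1; apply: torus_coef.
  + have [q [v [Pq Pv qv vq e]]] := Xq ik k_n.
    rewrite e -!mulrA XYk mulr1.
    by apply: TM; [apply: torus_coef | apply: torus_X].
  + have [q [v [Pq Pv qv vq e]]] := Xq ik k_n.
    have i_n := ltn_trans ik k_n.
    have -> : X k * Y i * Y k = Y i * v.
      symmetry; apply: (@inv_uniq _ (q * X i)).
        by rewrite -mulrA [v * _]mulrA vq mul1r YX.
      have -> : q * X i = X k * X i * Y k by rewrite e -!mulrA XYk mulr1.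
      rewrite -!mulrA [Y k * _]mulrA YXk mul1r [X i * _]mulrA XY //.
      by rewrite mul1r.
    by apply: TM; [apply: torus_Y | apply: torus_coef].
- case=> [Pb|[i ik [->|->]]].
  + by rewrite YC // -mulrA YXk mulr1; apply: torus_coef.
  + have [q [v [Pq Pv qv vq e]]] := Xq ik k_n.
    have -> : Y k * X i * X k = v * X i.
      rewrite -mulrA; have -> : X i * X k = X k * (v * X i).
        by rewrite mulrA [X k * v]XC // -mulrA e mulrA vq mul1r.
      by rewrite mulrA YXk mul1r.
    by apply: TM; [apply: torus_coef | apply: torus_X].
  + have [q [v [Pq Pv qv vq e]]] := Xq ik k_n.
    have i_n := ltn_trans ik k_n.
    have -> : Y k * Y i * X k = Y i * q.
      apply: (@inv_uniq _ (v * X i)); last first.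
        by rewrite -mulrA [X i * _]mulrA XY // mul1r.
      have -> : v * X i = Y k * (X i * X k).
        have -> : X i * X k = X k * (v * X i).
          by rewrite mulrA [X k * v]XC // -mulrA e mulrA vq mul1r.
        by rewrite mulrA YXk mul1r.
      rewrite -!mulrA [X k * _]mulrA XYk mul1r [Y i * _]mulrA YX //.
      by rewrite mul1r.
    by apply: TM; [apply: torus_Y | apply: torus_coef].
Qed.

Theorem torus_noetherian k :
  (k <= n)%N -> noetherian_in P -> noetherian_in (torus k).
Proof.
move=> kn P_noeth; elim: k kn => [_|k IHk k_n].
  suff -> : torus 0 = P by [].
  apply/funext => r; apply/propext; split; last exact: torus_coef.
  by move=> Tr; apply: (Tr P P_subring) => a [|[]].
apply: (@hilbert_basis R (torus k) (torus k.+1) (X k) (Y k)).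
- exact: XY.
- exact: YX.
- exact: torus_subring.
- exact: torus_subring.
- by move=> a /(torus_conj k_n)[].
- by move=> a /(torus_conj k_n)[].
- move=> a ka; apply: (ka (torus k.+1) (torus_subring _)).
  move=> b [Pb|[i ik [->|->]]].
  + exact: torus_coef.
  + by apply: torus_X; rewrite ltnS ltnW.
  + by apply: torus_Y; rewrite ltnS ltnW.
- exact: torus_X.
- exact: torus_Y.
- move=> r Q kr hQ PQ Qx Qy; apply: (kr Q hQ) => a [Pa|[i]].
    by apply/PQ; apply: torus_coef.
  rewrite ltnS leq_eqVlt => /orP[/eqP->|ik] [] -> //; apply: PQ.
    exact: torus_X.
  exact: torus_Y.
- exact/IHk/ltnW.
Qed.

End QuantumTorus.

(** * Noetherian rings and noetherian subrings *)

Lemma image_subring (U R : pzRingType) (phi : {rmorphism U -> R}) :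
  is_subring (fun r => exists u, r = phi u).
Proof.
split=> [|_ _ [u ->] [w ->]|_ _ [u ->] [w ->]].
- by exists 1; rewrite rmorph1.
- by exists (u - w); rewrite rmorphB.
- by exists (u * w); rewrite rmorphM.
Qed.

Lemma left_ideal_in_sum (R : pzRingType) (P I : R -> Prop) n (c g : 'I_n -> R) :
  left_ideal_in P I -> (forall i, P (c i)) -> (forall i, I (g i)) ->
  I (\sum_(i < n) c i * g i).
Proof.
case=> I0 ID IM Pc Ig; apply: big_ind => // i _; exact: IM.
Qed.

(** The combinations of the members of [g] form an ideal that contains [g]. *)
Lemma left_spanP (R : pzRingType) (P : R -> Prop) (g : seq R) a :
  is_subring P -> left_span P g a ->
  exists2 c : 'I_(size g) -> R, forall i, P (c i)
    & a = \sum_(i < size g) c i * g`_i.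
Proof.
move=> hP; case: (hP) => P1 PB PM sa.
apply: (sa (fun a => exists2 c : 'I_(size g) -> R, forall i, P (c i)
    & a = \sum_(i < size g) c i * g`_i)).
  split.
  - exists (fun=> 0) => [_|]; first exact: subring0.
    by rewrite big1 // => i _; rewrite mul0r.
  - move=> _ _ [c Pc ->] [d Pd ->]; exists (fun i => c i + d i) => [i|].
      exact: subringD.
    by rewrite -big_split; apply: eq_bigr => i _; rewrite mulrDl.
  - move=> r _ Pr [c Pc ->]; exists (fun i => r * c i) => [i|]; first exact: PM.
    by rewrite mulr_sumr; apply: eq_bigr => i _; rewrite mulrA.
move=> y yg; have iy : (index y g < size g)%N by rewrite index_mem.
exists (fun i => (i == Ordinal iy)%:R) => [i|].
  by case: (_ == _); [exact: P1 | exact: subring0].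
rewrite (bigD1 (Ordinal iy)) //= eqxx mul1r nth_index // big1 ?addr0 //.
by move=> i /negPf ->; rewrite mul0r.
Qed.

(** Ideals of the image are pulled back to [U]. *)
Lemma image_left_noetherian (U R : pzRingType) (phi : {rmorphism U -> R}) :
  left_noetherian U -> left_noetherian_in (fun r => exists u, r = phi u).
Proof.
move=> nU I hI Iphi; case: (hI) => I0 ID IM.
have [|n [g gI]] := nU (fun u => I (phi u)).
  split=> [|a b Ia Ib|r a Ia]; first by rewrite rmorph0.
    by rewrite rmorphD; apply: ID.
  by rewrite rmorphM; apply: IM => //; exists r.
exists [seq phi (g i) | i <- enum 'I_n]; split=> [_ /mapP[i _ ->]|a Ia].
  apply/gI; exists (fun j => (j == i)%:R).
  rewrite (bigD1 i) //= eqxx mul1r big1 ?addr0 // => j /negPf ->.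
  by rewrite mul0r.
have [u a_u] := Iphi a Ia; rewrite a_u in Ia *.
have [c ->] := (gI u).1 Ia => K hK gK; rewrite rmorph_sum.
under eq_bigr do rewrite rmorphM; apply: left_ideal_in_sum hK _ _ => i.
  by exists (c i).
by apply/gK/map_f; rewrite mem_enum.
Qed.

(** Conversely, when [phi] is injective, an ideal of [U] is finitely generated
    as soon as its image is. *)
Lemma embedding_left_noetherian (U R : pzRingType) (phi : {rmorphism U -> R}) :
  injective phi -> left_noetherian_in (fun r => exists u, r = phi u) ->
  left_noetherian U.
Proof.
move=> phi_inj nphi I [I0 ID IM].
pose phiI r := exists2 u, I u & r = phi u.
have [||g [gI gspan]] := nphi phiI.
- split=> [|_ _ [a Ia ->] [b Ib ->]|_ _ [r ->] [a Ia ->]].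
  + by exists 0; rewrite ?rmorph0.
  + by exists (a + b); [exact: ID | rewrite rmorphD].
  + by exists (r * a); [exact: IM | rewrite rmorphM].
- by move=> _ [u _ ->]; exists u.
have /fin_all_exists[w wg] (i : 'I_(size g)) : exists u, I u /\ g`_i = phi u.
  by have [u Iu gu] := gI _ (mem_nth 0 (ltn_ord i)); exists u.
exists (size g), w => a; split=> [Ia|[c ->]]; last first.
  apply: (@left_ideal_in_sum U (fun=> True) I) => //.
    by split=> // r b _; apply: IM.
  by move=> i; case: (wg i).
have [|c Pc a_c] := left_spanP (image_subring phi) (gspan (phi a) _).
  by exists a.
have [d dc] := fin_all_exists Pc.
exists d; apply: phi_inj; rewrite a_c rmorph_sum; apply: eq_bigr => i _.
by rewrite rmorphM dc; case: (wg i) => _ ->.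
Qed.

Section ConverseMorphism.
Variables (U R : pzRingType) (phi : {rmorphism U -> R}).

(** A copy of [phi] between the converse rings, to carry its own morphism
    structure. *)
Definition converse_fun : U^c -> R^c := phi.

Lemma converse_fun_nmod : nmod_morphism converse_fun.
Proof. by split=> [|a b]; [exact: (rmorph0 phi) | exact: (rmorphD phi)]. Qed.

Lemma converse_fun_monoid : monoid_morphism converse_fun.
Proof. by split=> [|a b]; [exact: (rmorph1 phi) | exact: (rmorphM phi)]. Qed.

HB.instance Definition _ :=
  GRing.isNmodMorphism.Build U^c R^c converse_fun converse_fun_nmod.
HB.instance Definition _ :=
  GRing.isMonoidMorphism.Build U^c R^c converse_fun converse_fun_monoid.

Lemma image_noetherian :
  noetherian U -> noetherian_in (fun r => exists u, r = phi u).
Proof.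
case=> lU rU; split; first exact: image_left_noetherian.
exact: (@image_left_noetherian U^c R^c converse_fun rU).
Qed.

Lemma embedding_noetherian : injective phi ->
  noetherian_in (fun r => exists u, r = phi u) -> noetherian U.
Proof.
move=> phi_inj [lP rP]; split; first exact: embedding_left_noetherian lP.
exact: (@embedding_left_noetherian U^c R^c converse_fun phi_inj rP).
Qed.

End ConverseMorphism.

Section SubringType.
Variables (R : pzRingType) (P : R -> Prop).

Definition subring_pred : pred R := fun r => `[< P r >].

(** The proof that [P] is a subring is a parameter of the type, so that the ring
    structure can be inferred from the type alone. *)
Definition subring_type of is_subring P : Type := {r : R | subring_pred r}.

Variable hP : is_subring P.

Lemma subring_pred_closed : subring_closed subring_pred.
Proof.
case: hP => P1 PB PM; split; first exact/asboolP.
  by move=> a b /asboolP Pa /asboolP Pb; apply/asboolP/PB.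
by move=> a b /asboolP Pa /asboolP Pb; apply/asboolP/PM.
Qed.

HB.instance Definition _ := SubChoice.on (subring_type hP).
HB.instance Definition _ := GRing.SubChoice_isSubPzRing.Build
  R subring_pred (subring_type hP) subring_pred_closed.

Lemma subring_type_noetherian :
  noetherian_in P -> noetherian (subring_type hP).
Proof.
move=> P_noeth.
pose v : {rmorphism subring_type hP -> R} := (val : subring_type hP -> R).
apply: (@embedding_noetherian _ _ v); first exact: val_inj.
suff -> : (fun r => exists u, r = v u) = P by [].
apply/funext => r; apply/propext; split=> [[u ->]|Pr].
  exact/asboolP/(valP u).
by exists (Sub r (introT (asboolP _) Pr)); symmetry; apply: SubK.
Qed.

End SubringType.

(** * Iterated extensions *)

Section Tower.
Variables (n : nat) (T : nat -> pzRingType).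
Variables (iota : forall j, {rmorphism T j -> T j.+1}).
Variables (f : forall j, {rmorphism T j -> T j}) (x xinv : forall j, T j.+1).

Lemma tower_base_nmod j : nmod_morphism (tower_base iota j).
Proof.
by elim: j => [|j [b0 bD]]; split=> //= [|a b];
  rewrite ?b0 ?bD ?rmorph0 ?rmorphD.
Qed.

Lemma tower_base_monoid j : monoid_morphism (tower_base iota j).
Proof.
by elim: j => [|j [b1 bM]]; split=> //= [|a b];
  rewrite ?b1 ?bM ?rmorph1 ?rmorphM.
Qed.

HB.instance Definition _ j := GRing.isNmodMorphism.Build
  (T 0%N) (T j) (tower_base iota j) (tower_base_nmod j).
HB.instance Definition _ j := GRing.isMonoidMorphism.Build
  (T 0%N) (T j) (tower_base iota j) (tower_base_monoid j).

Hypothesis hR : iterated_skew_laurent n iota f x xinv.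

Lemma tower_var_inv i m : (i < m)%N -> (m <= n)%N ->
  tower_var iota x i m * tower_var iota xinv i m = 1 /\
  tower_var iota xinv i m * tower_var iota x i m = 1.
Proof.
elim: m => // m IHm; rewrite ltnS leq_eqVlt => im mn /=.
case: eqP im => [-> _|_ /= im]; first by have [] := hR mn.
by have [e1 e2] := IHm im (ltnW mn); rewrite -!rmorphM e1 e2 rmorph1.
Qed.

Lemma tower_var_base i m s :
  (forall j, (j < n)%N -> forall s : T 0%N,
     f j (tower_base iota j s) = tower_base iota j s) ->
  (i < m)%N -> (m <= n)%N ->
  tower_var iota x i m * tower_base iota m s =
  tower_base iota m s * tower_var iota x i m.
Proof.
move=> hS; elim: m => // m IHm; rewrite ltnS leq_eqVlt => im mn /=.
case: eqP im => [-> _|_ /= im]; last by rewrite -!rmorphM IHm // ltnW.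
by have [_ _ _ comm _ _] := hR mn; rewrite comm hS.
Qed.

(** The relation arises at stage [j.+1], where [x j] is adjoined and acts by
    [f j], and is transported up the tower. *)
Lemma tower_var_comm i j q m : (i < j)%N -> (j < m)%N -> (m <= n)%N ->
  f j (tower_var iota x i j) = tower_base iota j q * tower_var iota x i j ->
  tower_var iota x j m * tower_var iota x i m =
  tower_base iota m q * (tower_var iota x i m * tower_var iota x j m).
Proof.
move=> ij + + fq; elim: m => // m IHm; rewrite ltnS leq_eqVlt => jm mn /=.
have im : (i < m)%N by case/orP: jm => [/eqP <-|/(ltn_trans ij)].
rewrite (ltn_eqF im); case: eqP jm => [jm _|_ /= jm].
  have [_ _ _ comm _ _] := hR mn.
  by case: _ / jm comm => comm; rewrite comm fq rmorphM mulrA.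
by rewrite -!rmorphM IHm // ltnW.
Qed.

Lemma subring_zpow (R : pzRingType) (Q : R -> Prop) (u v : R) k :
  is_subring Q -> Q u -> Q v -> Q (zpow u v k).
Proof. by move=> hQ Qu Qv; case: k => k /=; apply: subringX. Qed.

Definition tower_supported m (t : T m) (s : seq (T 0%N)) : Prop :=
  forall Q : T m -> Prop, is_subring Q ->
    (forall a, a \in s -> Q (tower_base iota m a)) ->
    (forall i, (i < m)%N ->
       Q (tower_var iota x i m) /\ Q (tower_var iota xinv i m)) -> Q t.

Lemma tower_supportedS m t s s' :
  {subset s <= s'} -> @tower_supported m t s -> tower_supported t s'.
Proof. by move=> ss' ts Q hQ s'Q; apply: ts => // a /ss'; apply: s'Q. Qed.

(** The members of the support are the elements of [T 0] among the iterated
    coefficients of [t]; at each step the predicate [Q] is pulled back along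
    [iota m]. *)
Lemma tower_finitely_supported m t : (m <= n)%N ->
  exists s, @tower_supported m t s.
Proof.
elim: m t => [|m IHm] t mn.
  by exists [:: t] => Q _ Qt _; apply: Qt (mem_head _ _).
have [_ _ _ _ span _] := hR mn; have [l [c [_ ->]]] := span t.
have [||s [_ sK]] := @seq_collect _ _ (fun=> True)
  (fun k => tower_supported (c k)) l.
- by move=> k; apply: tower_supportedS.
- by move=> k _; have [s sK] := IHm (c k) (ltnW mn); exists s.
exists s => Q hQ sQ varQ; rewrite big_seq; apply: big_ind => [|a b|k kl].
- exact: subring0.
- exact: subringD.
case: (hQ) => Q1 QB QM; apply: (QM); last first.
  have /= := varQ m (ltnSn m); rewrite eqxx => -[Qx Qxi].
  exact: subring_zpow.
apply: (sK k kl (fun a => Q (iota m a))) => //.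
  split=> [|a b|a b]; rewrite ?rmorph1 ?rmorphB ?rmorphM //; first exact: QB.
  exact: QM.
by move=> i im; have /= := varQ i (ltnW im); rewrite (ltn_eqF im).
Qed.

End Tower.

(** * Finitely generated pieces are noetherian *)

Theorem proposition1p3 (n : nat) (T : nat -> pzRingType)
    (iota : forall j, {rmorphism T j -> T j.+1})
    (f : forall j, {rmorphism T j -> T j})
    (x xinv : forall j, T j.+1)
    (hR : iterated_skew_laurent n iota f x xinv)
    (hx : forall i j, (i < j)%N -> (j < n)%N ->
      exists q : T 0%N, invertible q /\
        f j (tower_var iota x i j) =
          tower_base iota j q * tower_var iota x i j)
    (hS : forall j, (j < n)%N -> forall s : T 0%N,
      f j (tower_base iota j s) = tower_base iota j s) :
  F_noetherian (T 0%N) -> F_noetherian (T n).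
Proof.
move=> S_Fnoeth F.
pose q_in (s : seq (T 0%N)) i j := (i < j)%N ->
  exists q v : T 0%N, [/\ q \in s, v \in s, q * v = 1, v * q = 1 &
    f j (tower_var iota x i j) = tower_base iota j q * tower_var iota x i j].
have q_in_mono i j s s' : {subset s <= s'} -> q_in s i j -> q_in s' i j.
  by move=> ss' sq /sq[q [v [/ss' ? /ss' ? ? ? ?]]]; exists q, v.
have [sq sqP] : exists s, forall j, (j < n)%N ->
    forall i, (i < n)%N -> q_in s i j.
  apply: seq_collect_nat => [j s s' ss' sj i /sj|j jn]; first exact: q_in_mono.
  apply: seq_collect_nat => [i s s'|i _]; first exact: q_in_mono.
  case: (ltnP i j) => [ij|ji].
    have [q [[v [qv vq]] fq]] := hx i j ij jn; exists [:: q; v] => _.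
    by exists q, v; rewrite !inE !eqxx orbT.
  by exists [::]; rewrite /q_in ltnNge ji.
have [||sF [_ sFP]] := @seq_collect _ _ (fun=> True)
  (@tower_supported _ iota x xinv n) F.
- exact: tower_supportedS.
- move=> t _; have [s sK] := tower_finitely_supported hR t (leqnn n).
  by exists s.
have [P0 [U [sU U_noeth]]] := S_Fnoeth (sq ++ sF).
pose phi : {rmorphism U -> T n} :=
  (tower_base iota n : {rmorphism T 0%N -> T n}) \o
  (val : {rmorphism U -> T 0%N}).
pose P r := exists u, r = phi u.
have memP a : a \in sq ++ sF -> P (tower_base iota n a).
  by move=> /sU P0a; exists (Sub a P0a); rewrite /= SubK.
pose X i := tower_var iota x i n; pose Y i := tower_var iota xinv i n.
have L_noeth : noetherian_in (torus P X Y n).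
  apply: (@torus_noetherian _ P X Y n) => //.
  - exact: image_subring.
  - by move=> i i_n; have [] := tower_var_inv hR i_n (leqnn n).
  - by move=> i i_n; have [] := tower_var_inv hR i_n (leqnn n).
  - by move=> i _ i_n [u ->]; apply: (tower_var_base hR).
  - move=> i j ij jn.
    have [q [v [qs vs qv vq fq]]] := sqP j jn i (ltn_trans ij jn) ij.
    exists (tower_base iota n q), (tower_base iota n v); split.
    + by apply: memP; rewrite mem_cat qs.
    + by apply: memP; rewrite mem_cat vs.
    + by rewrite -rmorphM qv rmorph1.
    + by rewrite -rmorphM vq rmorph1.
    + exact: (tower_var_comm hR).
  - exact: image_noetherian.
pose hL := torus_subring P X Y n.
exists (subring_pred (torus P X Y n)), (subring_type hL); split; last first.
  exact: subring_type_noetherian.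
move=> t tF; apply/asboolP; apply: sFP tF _ hL _ _ => [a as_|i i_n].
  by apply: torus_coef; apply: memP; rewrite mem_cat as_ orbT.
by split; [apply: torus_X | apply: torus_Y].
Qed.
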